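(* Every full tripos $P\colon \mathsf{Set}^{\mathrm{op}}\to\mathsf{InfSl}$ whose base category is the category $\mathsf{Set}$ of sets (with the axiom of choice) is $\exists$-supercompactifiable.
   Context: $\mathsf{Set}$ is the category of sets formalized in the classical axiomatic set theory ZFC. A lex primary doctrine is a functor $P\colon \mathcal{C}^{\mathrm{op}}\to\mathsf{InfSl}$, where $\mathcal{C}$ has finite limits and $\mathsf{InfSl}$ is the category of inf-semilattices (posets with finite meets, including top) and their homomorphisms. For $f\colon A\to B$ write $P_f\colon P(B)\to P(A)$. $P$ is full existential if for every arrow $f$ of $\mathcal{C}$ the map $P_f$ has a left adjoint $\exists_f$, satisfying Beck–Chevalley (for pullback squares) and Frobenius reciprocity. $P$ is a full first-order hyperdoctrine if it is full existential, each $P(A)$ is a Heyting algebra, each $P_f$ is a Heyting algebra homomorphism, and each $P_f$ also has a right adjoint $\forall_f$, these satisfying Beck–Chevalley. $P$ has weak power objects if for every object $X$ there are an object $\mathrm{P}X$ and an element $\in_X\in P(X\times\mathrm{P}X)$ such that for every object $Y$ and $\beta\in P(X\times Y)$ there is an arrow $\{\beta\}_X\colon Y\to\mathrm{P}X$ with $\beta=P_{\mathrm{id}_X\times\{\beta\}_X}(\in_X)$. A full tripos is a full first-order hyperdoctrine with weak power objects. Category of points $\mathcal{G}_P$: objects are pairs $(A,\alpha)$ with $\alpha\in P(A)$; arrows $(A,\alpha)\to(B,\beta)$ are arrows $f\colon A\to B$ of $\mathcal{C}$ with $\alpha\le P_f(\beta)$. It has finite limits. Weak dependent products: a weak dependent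 product of $f\colon X\to J$ along $g\colon J\to I$ consists of an arrow $h\colon Z\to I$ and an arrow $e\colon E\to X$, where $E$ is the pullback of $g$ and $h$, such that $fe$ is the projection $E\to J$, and such that for any other such data $h'\colon Z'\to I$, $e'\colon E'\to X$ (with $E'$ the pullback of $g$ and $h'$, and $fe'$ the projection $E'\to J$) there is $w\colon Z'\to Z$ with $h'=hw$ and $e'=ek$, where $k\colon E'\to E$ is induced by $w$. A category has weak dependent products if these exist for all such $f,g$. Generic proof: an arrow $\theta\colon\Theta\to\Lambda$ such that for every arrow $f\colon Y\to X$ there is $\upsilon_f\colon X\to\Lambda$ such that $f$ factors through the pullback $\upsilon_f^*\theta$ of $\theta$ along $\upsilon_f$ and $\upsilon_f^*\theta$ factors through $f$. A lex primary doctrine $P$ is $\exists$-supercompactifiable if $\mathcal{G}_P$ has weak dependent products and a generic proof. *)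

(* Defs.v *)
(* MathComp, with the classical axioms of mathcomp.classical.boolp *)
From mathcomp Require Import all_boot all_order boolp.

Set Implicit Arguments.
Unset Strict Implicit.
Unset Printing Implicit Defensive.

Import Order.Theory.
Local Open Scope order_scope.

Declare Scope category_scope.
Delimit Scope category_scope with C.
Reserved Notation "g ∘ f" (at level 40, left associativity).

Record category := Category {
  obj :> Type;
  hom : obj -> obj -> Type;
  idm : forall A, hom A A;
  compm : forall A B C, hom B C -> hom A B -> hom A C;
  compm1 : forall A B (f : hom A B), compm f (idm A) = f;
  comp1m : forall A B (f : hom A B), compm (idm B) f = f;
  compmA : forall A B C D (h : hom C D) (g : hom B C) (f : hom A B),
    compm h (compm g f) = compm (compm h g) f
}.
Arguments hom {c} A B.
Arguments idm {c} A.
Arguments compm {c A B C} g f.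

Notation "g ∘ f" := (compm g f) : category_scope.
Local Open Scope category_scope.

Definition is_terminal (C : category) (T : C) : Prop :=
  forall A : C, exists! t : hom A T, True.

Definition is_product (C : category) (A B AB : C)
    (p : hom AB A) (q : hom AB B) : Prop :=
  forall (T : C) (a : hom T A) (b : hom T B),
    exists! u : hom T AB, p ∘ u = a /\ q ∘ u = b.

(*  D --q--> B
    |p       |g
    A --f--> X   *)
Definition is_pullback (C : category) (A B X D : C)
    (f : hom A X) (g : hom B X) (p : hom D A) (q : hom D B) : Prop :=
  f ∘ p = g ∘ q /\
  forall (T : C) (a : hom T A) (b : hom T B), f ∘ a = g ∘ b ->
    exists! u : hom T D, p ∘ u = a /\ q ∘ u = b.

Definition has_finite_limits (C : category) : Prop :=
  (exists T : C, is_terminal T) /\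
  forall (A B X : C) (f : hom A X) (g : hom B X),
    exists (D : C) (p : hom D A) (q : hom D B), is_pullback f g p q.

Record lex_category := LexCategory {
  lex_cat :> category;
  lex_limits : has_finite_limits lex_cat
}.

(* In an order of type [tMeetSemilatticeType d], the display [d] is a phantom
   parameter, used only for printing. *)
Record lex_primary_doctrine (C : lex_category) := LexPrimaryDoctrine {
  fibre_display : Order.disp_t;
  fibre :> forall A : C, tMeetSemilatticeType fibre_display;
  reindex : forall A B : C, hom A B -> fibre B -> fibre A;
  reindexI : forall (A B : C) (f : hom A B) (b b' : fibre B),
    reindex f (b `&` b') = reindex f b `&` reindex f b';
  reindexT : forall (A B : C) (f : hom A B), reindex f \top = \top;
  reindex1 : forall (A : C) (a : fibre A), reindex (idm A) a = a;
  reindexM : forall (A B D : C) (g : hom B D) (f : hom A B) (d : fibre D),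
    reindex (g ∘ f) d = reindex f (reindex g d)
}.
Arguments reindex {C} P {A B} f b : rename.

Record full_existential (C : lex_category) (P : lex_primary_doctrine C) :=
FullExistential {
  ex_along : forall A B : C, hom A B -> P A -> P B;
  ex_adj : forall (A B : C) (f : hom A B) (a : P A) (b : P B),
    (ex_along f a <= b) = (a <= reindex P f b);
  ex_beck_chevalley : forall (A B X D : C) (f : hom A X) (g : hom B X)
    (p : hom D A) (q : hom D B), is_pullback f g p q ->
    forall a : P A, reindex P g (ex_along f a) = ex_along q (reindex P p a);
  ex_frobenius : forall (A B : C) (f : hom A B) (a : P A) (b : P B),
    ex_along f (a `&` reindex P f b) = ex_along f a `&` b
}.

(* The operations are uniquely determined by the order. *)
Record heyting (d : Order.disp_t) (H : tMeetSemilatticeType d) := Heyting {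
  hbot : H;
  hjoin : H -> H -> H;
  himp : H -> H -> H;
  hbot_le : forall a, hbot <= a;
  hjoin_le : forall a b c, (hjoin a b <= c) = (a <= c) && (b <= c);
  le_himp : forall a b c, (c <= himp a b) = (c `&` a <= b)
}.

Record full_first_order_hyperdoctrine (C : lex_category)
    (P : lex_primary_doctrine C) := FullFirstOrderHyperdoctrine {
  fo_existential :> full_existential P;
  fo_heyting : forall A : C, heyting (P A);
  reindex_bot : forall (A B : C) (f : hom A B),
    reindex P f (hbot (fo_heyting B)) = hbot (fo_heyting A);
  reindex_join : forall (A B : C) (f : hom A B) (b b' : P B),
    reindex P f (hjoin (fo_heyting B) b b')
      = hjoin (fo_heyting A) (reindex P f b) (reindex P f b');
  reindex_imp : forall (A B : C) (f : hom A B) (b b' : P B),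
    reindex P f (himp (fo_heyting B) b b')
      = himp (fo_heyting A) (reindex P f b) (reindex P f b');
  all_along : forall A B : C, hom A B -> P A -> P B;
  all_adj : forall (A B : C) (f : hom A B) (a : P A) (b : P B),
    (b <= all_along f a) = (reindex P f b <= a);
  all_beck_chevalley : forall (A B X D : C) (f : hom A X) (g : hom B X)
    (p : hom D A) (q : hom D B), is_pullback f g p q ->
    forall a : P A, reindex P g (all_along f a) = all_along q (reindex P p a)
}.

(* [k] is the arrow id x h : X x Y -> X x PX. *)
Definition has_weak_power_objects (C : lex_category)
    (P : lex_primary_doctrine C) : Prop :=
  forall X : C,
  exists (PX XPX : C) (p : hom XPX X) (q : hom XPX PX) (mem : P XPX),
    is_product p q /\
    forall (Y XY : C) (p' : hom XY X) (q' : hom XY Y), is_product p' q' ->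
    forall b : P XY, exists (h : hom Y PX) (k : hom XY XPX),
      [/\ p ∘ k = p', q ∘ k = h ∘ q' & b = reindex P k mem].

Record full_tripos (C : lex_category) (P : lex_primary_doctrine C) :=
FullTripos {
  tripos_hyperdoctrine :> full_first_order_hyperdoctrine P;
  tripos_power : has_weak_power_objects P
}.

Section CategoryOfPoints.
Variables (C : lex_category) (P : lex_primary_doctrine C).

Definition point : Type := {A : C & P A}.

Definition point_hom (a b : point) : Type :=
  {f : hom (tag a) (tag b) | tagged a <= reindex P f (tagged b)}.

Fact point_idm_subproof (a : point) :
  tagged a <= reindex P (idm (tag a)) (tagged a).
Proof. by rewrite reindex1. Qed.

Fact point_compm_subproof (a b c : point)
    (g : point_hom b c) (f : point_hom a b) :
  tagged a <= reindex P (sval g ∘ sval f) (tagged c).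
Proof.
case: g f => [g leg] [f lef] /=; rewrite reindexM; apply: le_trans lef _.
by rewrite leEmeet -reindexI; move: leg; rewrite leEmeet => /eqP ->.
Qed.

Definition point_idm (a : point) : point_hom a a :=
  exist _ (idm (tag a)) (point_idm_subproof a).

Definition point_compm (a b c : point)
    (g : point_hom b c) (f : point_hom a b) : point_hom a c :=
  exist _ (sval g ∘ sval f) (point_compm_subproof g f).

Fact point_hom_eq (a b : point) (f g : point_hom a b) :
  sval f = sval g -> f = g.
Proof.
case: f g => [f lef] [g leg] /= eq_fg; case: _ / eq_fg leg => leg.
by congr exist; apply: eq_irrelevance.
Qed.

Definition points : category.
Proof.
refine (@Category point point_hom point_idm point_compm _ _ _).
- by move=> a b f; apply: point_hom_eq; apply: compm1.
- by move=> a b f; apply: point_hom_eq; apply: comp1m.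
- by move=> a b c d h g f; apply: point_hom_eq; apply: compmA.
Defined.

End CategoryOfPoints.

Record wdp_data (C : category) (X J I : C) (f : hom X J) (g : hom J I) :=
WdpData {
  wdp_Z : C;
  wdp_h : hom wdp_Z I;
  wdp_E : C;
  wdp_prJ : hom wdp_E J;
  wdp_prZ : hom wdp_E wdp_Z;
  wdp_pullback : is_pullback g wdp_h wdp_prJ wdp_prZ;
  wdp_e : hom wdp_E X;
  wdp_over : f ∘ wdp_e = wdp_prJ
}.

(* The two equations on [wdp_prJ] and [wdp_prZ] say that [k] is the arrow
   between the pullbacks induced by [w]. *)
Definition is_weak_dependent_product (C : category) (X J I : C)
    (f : hom X J) (g : hom J I) (D : wdp_data f g) : Prop :=
  forall D' : wdp_data f g,
  exists (w : hom (wdp_Z D') (wdp_Z D)) (k : hom (wdp_E D') (wdp_E D)),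
    [/\ wdp_prJ D ∘ k = wdp_prJ D',
        wdp_prZ D ∘ k = w ∘ wdp_prZ D',
        wdp_h D' = wdp_h D ∘ w
      & wdp_e D' = wdp_e D ∘ k].

Definition has_weak_dependent_products (C : category) : Prop :=
  forall (X J I : C) (f : hom X J) (g : hom J I),
  exists D : wdp_data f g, is_weak_dependent_product D.

Definition factors_through (C : category) (A B X : C)
    (f : hom A X) (g : hom B X) : Prop :=
  exists u : hom A B, f = g ∘ u.

Definition is_generic_proof (C : category) (Theta Lambda : C)
    (theta : hom Theta Lambda) : Prop :=
  forall (Y X : C) (f : hom Y X),
  exists (v : hom X Lambda) (W : C) (v_theta : hom W X) (q : hom W Theta),
    [/\ is_pullback v theta v_theta q,
        factors_through f v_theta
      & factors_through v_theta f].

Definition has_generic_proof (C : category) : Prop :=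
  exists (Theta Lambda : C) (theta : hom Theta Lambda), is_generic_proof theta.

Definition exists_supercompactifiable (C : lex_category)
    (P : lex_primary_doctrine C) : Prop :=
  has_weak_dependent_products (points P) /\ has_generic_proof (points P).

(* Sets are the types of a fixed universe; with the axioms of boolp this is a
   category of classical sets satisfying choice (see [set_choice] below). *)
Definition set_cat : category :=
  @Category Type (fun A B => A -> B) (fun A x => x)
    (fun A B C g f x => g (f x))
    (fun A B f => erefl) (fun A B f => erefl) (fun A B C D h g f => erefl).

Fact set_cat_has_finite_limits : has_finite_limits set_cat.
Proof.
split.
  exists unit => A; exists (fun _ => tt); split=> // t _.
  by apply/funext => x; case: (t x).
move=> A B X f g; exists {ab : A * B | f ab.1 = g ab.2}.
exists (fun d => (sval d).1), (fun d => (sval d).2); split.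
  by apply/funext => -[].
move=> T a b /= /funeqP fab.
exists (fun t => exist _ (a t, b t) (fab t)); split=> // u [ua ub].
apply/funext => t; case: _ / ua fab => fab; case: _ / ub fab => fab /=.
by case: (u t) (fab t) => -[x y] /= e e'; congr exist; apply: Prop_irrelevance.
Qed.

Definition set_lex : lex_category := LexCategory set_cat_has_finite_limits.

Fact set_choice (A B : set_lex) (f : hom A B) :
  (forall b, exists a, f a = b) -> exists s : hom B A, f ∘ s = idm B.
Proof. by move=> /choice[s sP]; exists s; apply/funext. Qed.

(* Main.v *)
(** Weak dependent products in the category of points are computed as in sets:
    on the set [Z] of pairs of a point [i] and a section of [f] over the fibre
    of [g] at [i], put the predicate "[i] satisfies [iota], and for all [j] in
    the fibre, [gamma j] implies [xi] at the value of the section at [j]".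

    For the generic proof, let [Sigma] be a weak power object of the point, so
    that every predicate on [Y] is classified by some [b : Y -> Sigma]. By the
    axiom of choice an arrow [f] out of [Y] with predicate [b] is equivalent,
    over its codomain [X], to the image of [(f, b)] in [X * Sigma] with the
    tautological predicate. Such a subset is a map from [X] to the powerset of
    [Sigma], so the membership relation of [Sigma] is a generic proof. *)
From mathcomp Require Import all_boot all_order boolp.
Require Import Defs.

Set Implicit Arguments.
Unset Strict Implicit.
Unset Printing Implicit Defensive.

Import Order.Theory.
Local Open Scope order_scope.
Local Open Scope category_scope.

Section PointsPullback.
Variables (C : lex_category) (P : lex_primary_doctrine C).
Variables (a b x : point P) (f : point_hom a x) (g : point_hom b x).
Variables (D : C) (p : hom D (tag a)) (q : hom D (tag b)).

(** The largest predicate on [D] for which both [p] and [q] are arrows of points. *)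
Definition pb_point : point P :=
  existT _ D (reindex P p (tagged a) `&` reindex P q (tagged b)).

Definition pb_fst : point_hom pb_point a :=
  exist (fun r => tagged pb_point <= reindex P r (tagged a)) p (leIl _ _).

Definition pb_snd : point_hom pb_point b :=
  exist (fun r => tagged pb_point <= reindex P r (tagged b)) q (leIr _ _).

Lemma points_pullback :
  is_pullback (sval f) (sval g) p q ->
  @is_pullback (points P) a b x pb_point f g pb_fst pb_snd.
Proof.
move=> [fpgq univ]; split; first exact: point_hom_eq.
move=> t s r /(congr1 sval) /= fsgr.
have [u [[pu qu] uniq_u]] := univ _ _ _ fsgr.
have leu : tagged t <= reindex P u (tagged pb_point).
  by rewrite reindexI -!reindexM pu qu lexI (svalP s) (svalP r).
exists (exist _ u leu); split; first by split; apply: point_hom_eq.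
move=> v [pv qv]; apply: point_hom_eq; apply: uniq_u.
by split; [rewrite -pv | rewrite -qv].
Qed.

End PointsPullback.

Section SetPullback.
Variables (A B X : set_lex) (f : hom A X) (g : hom B X).

Definition set_pb : set_lex := {ab : A * B | f ab.1 = g ab.2}.
Definition set_pb1 : hom set_pb A := fun d => (sval d).1.
Definition set_pb2 : hom set_pb B := fun d => (sval d).2.

Lemma set_pb_eq (c d : set_pb) :
  set_pb1 c = set_pb1 d -> set_pb2 c = set_pb2 d -> c = d.
Proof.
case: c d => -[a b] /= ab [[a' b'] /= ab'] ea eb; rewrite /set_pb1 /set_pb2 /= in ea eb.
by case: _ / ea ab'; case: _ / eb => ab'; congr exist; apply: Prop_irrelevance.
Qed.

Lemma set_pb_pullback : is_pullback f g set_pb1 set_pb2.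
Proof.
split; first by apply/funext => -[].
move=> T a b /funeqP fagb; exists (fun t => exist _ (a t, b t) (fagb t)).
split=> // u [ua ub]; apply/funext => t.
by apply: set_pb_eq; [have /funeqP/(_ t) := ua | have /funeqP/(_ t) := ub].
Qed.

End SetPullback.

Section WeakDependentProduct.
Variables (P : lex_primary_doctrine set_lex) (TP : full_tripos P).
Variables (X J I : point P) (f : point_hom X J) (g : point_hom J I).

Definition wdp_set : set_lex :=
  {i : tag I & forall j, sval g j = i -> {x : tag X | sval f x = j}}.
Definition wdp_set_h : hom wdp_set (tag I) := fun z => tag z.
Definition wdp_set_E : set_lex := set_pb (sval g) wdp_set_h.
Definition wdp_set_e : hom wdp_set_E (tag X) :=
  fun d => sval (tagged (set_pb2 d) (set_pb1 d) (svalP d)).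

(** The right adjoint along the projection from [wdp_set_E] to [wdp_set] expresses the quantifier
    over the fibre of [g]. *)
Definition wdp_pred : P wdp_set :=
  reindex P wdp_set_h (tagged I) `&`
  all_along TP (@set_pb2 _ _ _ (sval g) wdp_set_h)
    (himp (fo_heyting TP wdp_set_E)
       (reindex P (@set_pb1 _ _ _ (sval g) wdp_set_h) (tagged J))
       (reindex P wdp_set_e (tagged X))).

Definition wdp_point : point P := existT _ wdp_set wdp_pred.
Definition wdp_point_h : point_hom wdp_point I :=
  exist (fun r => wdp_pred <= reindex P r (tagged I)) wdp_set_h (leIl _ _).
Definition wdp_point_E : point P :=
  @pb_point _ P J wdp_point wdp_set_E (@set_pb1 _ _ _ _ _) (@set_pb2 _ _ _ _ _).

(** The adjunctions for implication and for the universal quantifier turn this into the projection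
    of [wdp_pred] to its second conjunct. *)
Lemma wdp_set_e_le :
  tagged wdp_point_E <= reindex P wdp_set_e (tagged X).
Proof.
rewrite /= meetC -(le_himp (fo_heyting TP wdp_set_E)) -(all_adj TP).
exact: leIr.
Qed.

Definition wdp_point_e : point_hom wdp_point_E X :=
  exist (fun r => tagged wdp_point_E <= reindex P r (tagged X))
    wdp_set_e wdp_set_e_le.

Lemma wdp_point_over : point_compm f wdp_point_e = pb_fst _ _.
Proof.
apply: point_hom_eq; apply/funext => d.
exact: svalP (tagged (set_pb2 d) (set_pb1 d) (svalP d)).
Qed.

Definition points_wdp : @wdp_data (points P) X J I f g :=
  @WdpData (points P) X J I f g wdp_point wdp_point_h wdp_point_E _ _
    (points_pullback (f := g) (g := wdp_point_h)
      (set_pb_pullback (sval g) wdp_set_h))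
    wdp_point_e wdp_point_over.

Section Universal.
Variables (Z' : point P) (h' : point_hom Z' I).
Let E' : point P :=
  @pb_point _ P J Z' (set_pb (sval g) (sval h'))
    (@set_pb1 _ _ _ _ _) (@set_pb2 _ _ _ _ _).
Variables (e' : point_hom E' X).
Hypothesis over' : forall d, sval f (sval e' d) = set_pb1 d.

(** The transpose of [e'], for competing data on the chosen pullback [set_pb]; arbitrary pullbacks
    are reduced to this case in [points_wdp_weak]. *)
Definition wdp_curry : hom (tag Z') wdp_set :=
  fun z => existT _ (sval h' z) (fun j gj =>
    exist (fun x => sval f x = j) (sval e' (exist _ (j, z) gj)) (over' _)).

Definition wdp_curry_E : hom (set_pb (sval g) (sval h')) wdp_set_E :=
  fun d => exist (fun jz : tag J * wdp_set => sval g jz.1 = wdp_set_h jz.2)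
    (set_pb1 d, wdp_curry (set_pb2 d)) (svalP d).

Lemma wdp_eval_curry : wdp_set_e ∘ wdp_curry_E = sval e'.
Proof.
apply/funext => d /=; rewrite /wdp_set_e /=; congr (sval e' _).
exact: set_pb_eq.
Qed.

(** Pasting of pullbacks, as [wdp_set_h ∘ wdp_curry] is [h']. This is the square to which
    [wdp_curry_le] applies Beck-Chevalley. *)
Lemma wdp_curry_pullback :
  is_pullback (@set_pb2 _ _ _ (sval g) wdp_set_h) wdp_curry
    wdp_curry_E (@set_pb2 _ _ _ (sval g) (sval h')).
Proof.
split=> // T a b /funeqP eq_ab.
have gh t : sval g (set_pb1 (a t)) = sval h' (b t).
  by rewrite (svalP (a t)); apply: (congr1 wdp_set_h (eq_ab t)).
exists (fun t => exist _ (set_pb1 (a t), b t) (gh t)); split.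
  split=> //; apply/funext => t; apply: set_pb_eq => //.
  exact/esym/eq_ab.
move=> u [ua ub]; apply/funext => t; apply: set_pb_eq.
  by rewrite -[LHS](congr1 (fun r => set_pb1 (r t)) ua).
exact/esym/(congr1 (@^~ t) ub).
Qed.

(** For the second conjunct, Beck-Chevalley carries reindexing past the universal quantifier; the
    adjunctions then leave the fact that [e'] is an arrow of points. *)
Lemma wdp_curry_le : tagged Z' <= reindex P wdp_curry wdp_pred.
Proof.
rewrite /wdp_pred reindexI lexI -reindexM (svalP h') /=.
rewrite (all_beck_chevalley TP wdp_curry_pullback) all_adj reindex_imp le_himp.
rewrite -!reindexM wdp_eval_curry meetC.
exact: (svalP e').
Qed.

End Universal.

Lemma points_wdp_weak : is_weak_dependent_product points_wdp.
Proof.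
move=> [Z' h' E' prJ prZ [sq univ] e' over].
(* The pullback [E'] is arbitrary: [u] and [c] compare it with the chosen one, and [w] will be the
   transpose of [e' ∘ u]. *)
have canon := points_pullback (f := g) (g := h')
  (set_pb_pullback (sval g) (sval h')).
have [u [[uJ uZ] _]] := univ _ _ _ canon.1.
have [c [[cJ cZ] _]] := canon.2 _ _ _ sq.
have uc : u ∘ c = idm E'.
  have [v [_ uniq_v]] := univ _ _ _ sq.
  rewrite -(uniq_v (idm E')) ?compm1 //; apply/esym/uniq_v.
  by rewrite !compmA uJ uZ.
have over' d : sval f (sval (point_compm e' u) d) = set_pb1 d.
  have: point_compm f (point_compm e' u) = pb_fst _ _.
    by rewrite -[RHS]uJ -over; apply: (@compmA (points P)).
  by move=> /(congr1 sval) /funeqP /(_ d).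
pose w : @hom (points P) Z' wdp_point :=
  exist _ (wdp_curry over') (wdp_curry_le over').
have hw : h' = point_compm wdp_point_h w by apply: point_hom_eq.
have sq' : point_compm g prJ = point_compm wdp_point_h (point_compm w prZ).
  by rewrite [LHS]sq hw; apply/esym/(@compmA (points P)).
have [k [[kJ kZ] _]] := (wdp_pullback points_wdp).2 _ _ _ sq'.
exists w, k; split=> //=.
(* With [e'] written as [(e' ∘ u) ∘ c], it remains to identify [k] by its two projections and
   evaluate the transpose. *)
rewrite -[LHS](@compm1 (points P)) -uc compmA; apply: point_hom_eq => /=.
have -> : sval k = wdp_curry_E over' ∘ sval c.
  apply/funext => y; apply: set_pb_eq.
    have /(congr1 sval)/funeqP/(_ y) /= -> := kJ.
    by have /(congr1 sval)/funeqP/(_ y) /= := cJ.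
  have /(congr1 sval)/funeqP/(_ y) /= -> := kZ.
  by have /(congr1 sval)/funeqP/(_ y) /= <- := cZ.
by apply/funext => y; rewrite -[LHS](congr1 (@^~ (sval c y)) (wdp_eval_curry over')).
Qed.

End WeakDependentProduct.

(** As [Y] is itself a product of [unit] and [Y], membership for [unit], pulled back along the
    section [s] of [q], classifies all predicates. *)
Lemma tripos_generic_predicate (P : lex_primary_doctrine set_lex) :
  has_weak_power_objects P ->
  exists (Sigma : set_lex) (sigma : P Sigma), forall (Y : set_lex) (b : P Y),
    exists h : hom Y Sigma, b = reindex P h sigma.
Proof.
move=> /(_ (unit : set_lex)) [S [US [p [q [mem [prod_pq classify]]]]]].
have [s [[_ qs] _]] := prod_pq S (fun=> tt) (idm S).
exists S, (reindex P s mem) => Y b.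
have prodY : @is_product set_lex unit Y Y (fun=> tt) (idm Y).
  move=> T a c; exists c; split=> [|u [_ <-]//]; split=> //.
  by apply/funext => t; case: (a t).
have [h [k [pk qk ->]]] := classify _ _ _ _ prodY b.
exists h; rewrite -reindexM; congr (reindex P _ mem).
(* [k] and [s ∘ h] have the same projections, hence are equal. *)
have [v [_ uniq_v]] := prod_pq Y (fun=> tt) h.
rewrite -(uniq_v k) //; apply: uniq_v; split.
  by apply/funext => y /=; case: (p _).
exact: (congr1 (fun r => compm r h) qs).
Qed.

Lemma points_generic_proof (P : lex_primary_doctrine set_lex) :
  has_weak_power_objects P -> has_generic_proof (points P).
Proof.
move=> /tripos_generic_predicate [S [sigma classify]].
pose T : set_lex := {Us : (S -> Prop) * S | Us.1 Us.2}.
pose L : set_lex := S -> Prop.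
(* The top predicate makes every map of sets into [L] an arrow of points. *)
pose Lambda : point P := existT (fun A : set_lex => P A) L \top.
pose snd : hom T S := fun d => (sval d).2.
pose Theta : point P := existT _ T (reindex P snd sigma).
pose fst : hom T (tag Lambda) := fun d => (sval d).1.
have le_fst : tagged Theta <= reindex P fst (tagged Lambda).
  by rewrite reindexT lex1.
exists Theta, Lambda, (exist _ fst le_fst) => Y X f.
have [b def_b] := classify _ (tagged Y).
(* The fibres over [X] of the image of [(f, b)]. *)
pose v : hom (tag X) (tag Lambda) :=
  fun x s => exists2 y, sval f y = x & b y = s.
have le_v : tagged X <= reindex P v (tagged Lambda) by rewrite reindexT lex1.
have pb := points_pullback (f := exist _ v le_v : point_hom X Lambda)
  (g := exist _ fst le_fst : point_hom Theta Lambda) (set_pb_pullback v fst).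
exists (exist _ v le_v); do 3 eexists; split.
- exact: pb.
- have vP y : v (sval f y) (b y) by exists y.
  pose u : hom (tag Y) (set_pb v fst) :=
    fun y => exist _ (sval f y, exist _ (v (sval f y), b y) (vP y)) erefl.
  have le_u : tagged Y <= reindex P u
      (reindex P (@set_pb1 _ _ _ v fst) (tagged X) `&`
       reindex P (@set_pb2 _ _ _ v fst) (tagged Theta)).
    by rewrite reindexI /= -!reindexM lexI (svalP f) /= def_b.
  by exists (exist _ u le_u); apply: point_hom_eq.
(* Choice splits [Y] onto the image of [(f, b)]. The splitting respects predicates because the one
   on [Y] depends only on the value of [b]. *)
- have /choice[s sP] (d : set_pb v fst) : exists y : tag Y,
      sval f y = set_pb1 d /\ b y = snd (set_pb2 d).
    case: d => -[x [[U t] /= Ut]] eq_U.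
    have: v x t by rewrite [v x]eq_U.
    by case=> y; exists y.
  have le_s : reindex P (@set_pb1 _ _ _ v fst) (tagged X) `&`
       reindex P (@set_pb2 _ _ _ v fst) (tagged Theta)
       <= reindex P (s : hom (set_pb v fst) (tag Y)) (tagged Y).
    rewrite def_b /= -!reindexM.
    have -> : b ∘ (s : hom (set_pb v fst) (tag Y)) = snd ∘ @set_pb2 _ _ _ v fst.
      by apply/funext => d; apply: (sP d).2.
    exact: leIr.
  exists (exist _ s le_s); apply: point_hom_eq; apply/funext => d /=.
  exact/esym/(sP d).1.
Qed.

Theorem corollary7p8 (P : lex_primary_doctrine set_lex) :
  full_tripos P -> exists_supercompactifiable P.
Proof.
move=> TP; split; last exact: points_generic_proof (tripos_power TP).
by move=> X J I f g; exists (points_wdp TP f g); apply: points_wdp_weak.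
Qed.
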